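(* Let $f_1(s)=\sum_{n\geq 1}\frac{a_n}{n^s}$, $a_n\in\mathbb{C}$, be an exponential sum which is equivalent to the Riemann zeta function $\zeta(s)=\sum_{n\ge1}\frac1{n^s}$. Then there exists an increasing unbounded sequence $\{\tau_n\}_{n\geq 1}$ of positive numbers such that the sequence of functions $\{\zeta(s+i\tau_n)\}_{n\geq 1}$ converges uniformly to $f_1(s)$ on every reduced strip of $\{s\in\mathbb{C}:\operatorname{Re}s>1\}$.
   Context: Equivalence: $\sum_{n\ge1}a_nn^{-s}$ is viewed as the exponential sum $\sum_{n\ge1}a_ne^{-s\log n}$ with exponents $\lambda_n=-\log n$, $n\ge1$. Two such sums $\sum_{n\ge1}a_nn^{-s}$ and $\sum_{n\ge1}b_nn^{-s}$ are equivalent if for each integer $N\ge1$ there exists a $\mathbb{Q}$-linear map $\psi_N:V_N\to\mathbb{R}$, where $V_N\subset\mathbb{R}$ is the $\mathbb{Q}$-vector space generated by $\{-\log 1,-\log2,\ldots,-\log N\}$, such that $b_n=a_ne^{i\psi_N(-\log n)}$ for $n=1,\ldots,N$. A reduced strip of $\{\operatorname{Re}s>1\}$ is a set $\{s:\sigma_1\le\operatorname{Re}s\le\sigma_2\}$ with $1<\sigma_1<\sigma_2<\infty$. *)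

(* Defs.v *)
From Stdlib Require Import Reals QArith Qreals Lra Lia.
From Coquelicot Require Import Coquelicot.
Open Scope R_scope.

Definition Cexp (z : C) : C :=
  (exp (Re z) * cos (Im z), exp (Re z) * sin (Im z)).

(* Meaningful only when [is_series u _] holds; see [is_series_dirichlet_sum]. *)
Definition CSeries (u : nat -> C) : C :=
  (Series (fun n => Re (u n)), Series (fun n => Im (u n))).

Definition expo (n : nat) : R := - ln (INR n).

(* [a n * n^(-s)], with [n^(-s)] read as [exp (expo n * s)]. *)
Definition dirichlet_term (a : nat -> C) (s : C) (n : nat) : C :=
  (a n * Cexp (RtoC (expo n) * s))%C.

(* The sum ranges over [n >= 1]: the coefficient [a 0] is never used. *)
Definition dirichlet_sum (a : nat -> C) (s : C) : C :=
  CSeries (fun k => dirichlet_term a s (S k)).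

Definition zeta_coef (n : nat) : C := RtoC 1.

(* The Riemann zeta function, on the half-plane [Re s > 1] only. *)
Definition zeta (s : C) : C := dirichlet_sum zeta_coef s.

(* The Q-vector space generated by [expo 1, ..., expo N]. *)
Definition VQ (N : nat) (x : R) : Prop :=
  exists c : nat -> Q, x = sum_n_m (fun n => Q2R (c n) * expo n) 1 N.

(* A Q-linear map [V -> R], represented by a function on [R] whose values
   outside [V] are irrelevant. *)
Definition Q_linear_on (V : R -> Prop) (psi : R -> R) : Prop :=
  (forall x y, V x -> V y -> psi (x + y) = psi x + psi y) /\
  (forall (q : Q) x, V x -> psi (Q2R q * x) = Q2R q * psi x).

Definition equivalent (a b : nat -> C) : Prop :=
  forall N : nat, (1 <= N)%nat ->
  exists psi : R -> R, Q_linear_on (VQ N) psi /\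
  forall n : nat, (1 <= n <= N)%nat ->
    b n = (a n * Cexp (Ci * RtoC (psi (expo n))))%C.

(* A reduced strip of [{s | Re s > 1}] is [strip s1 s2] with [1 < s1 < s2]. *)
Definition strip (s1 s2 : R) (s : C) : Prop := s1 <= Re s <= s2.

Definition converges_uniformly_on
    (D : C -> Prop) (g : nat -> C -> C) (f : C -> C) : Prop :=
  forall eps : R, 0 < eps ->
  exists n0 : nat, forall n : nat, (n0 <= n)%nat ->
  forall s : C, D s -> Cmod (g n s - f s) < eps.

Lemma Cmod_Cexp (z : C) : Cmod (Cexp z) = exp (Re z).
Proof.
  unfold Cmod, Cexp; simpl fst; simpl snd.
  replace (_ + _) with (exp (Re z) ^ 2).
  - apply sqrt_pow2, Rlt_le, exp_pos.
  - generalize (sin2_cos2 (Im z)); unfold Rsqr; intro H.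
    replace (exp (Re z) ^ 2)
      with (exp (Re z) ^ 2 * (sin (Im z) * sin (Im z) + cos (Im z) * cos (Im z)))
      by (rewrite H; ring).
    ring.
Qed.

Lemma ex_series_inv_pow (sigma : R) :
  1 < sigma -> ex_series (fun k => exp (expo (S k) * sigma)).
Proof.
  intro Hs.
  set (d := sigma - 1).
  assert (Hd : 0 < d) by (unfold d; lra).
  set (v := fun k : nat => exp (- d * ln (INR (S k)))).
  assert (Hstep : forall k, d * exp (expo (S (S k)) * sigma) <= v k - v (S k)).
  { intro k; unfold v, expo.
    set (x := INR (S k)).
    assert (Hx : 0 < x) by (apply lt_0_INR; lia).
    assert (Hy : INR (S (S k)) = x + 1) by (unfold x; rewrite (S_INR (S k)); ring).
    rewrite Hy.
    set (u := ln (x + 1) - ln x).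
    assert (Hu : / (x + 1) <= u).
    { assert (H := exp_ineq1_le (- u)).
      replace (exp (- u)) with (x / (x + 1)) in H.
      - replace (x / (x + 1)) with (1 - / (x + 1)) in H by (field; lra). lra.
      - unfold u. replace (- (ln (x + 1) - ln x)) with (ln x + - ln (x + 1)) by ring.
        rewrite exp_plus, exp_Ropp, !exp_ln by lra. reflexivity. }
    replace (- d * ln x) with (- d * ln (x + 1) + d * u) by (unfold u; ring).
    replace (- ln (x + 1) * sigma) with (- d * ln (x + 1) + - ln (x + 1))
      by (unfold d; ring).
    rewrite !exp_plus, (exp_Ropp (ln (x + 1))), exp_ln by lra.
    assert (H1 := exp_ineq1_le (d * u)).
    assert (H2 : d * / (x + 1) <= d * u) by (apply Rmult_le_compat_l; lra).
    assert (H3 := exp_pos (- d * ln (x + 1))).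
    nra. }
  apply ex_series_incr_1.
  apply (@ex_finite_lim_seq_incr _ (/ d * v O)).
  - intro n; rewrite sum_Sn.
    assert (H := exp_pos (expo (S (S (S n))) * sigma)).
    change plus with Rplus; lra.
  - intro n.
    assert (H : d * sum_n (fun k => exp (expo (S (S k)) * sigma)) n <= v O - v (S n)).
    { induction n as [|n IH].
      - rewrite sum_O; apply Hstep.
      - rewrite sum_Sn. change plus with Rplus.
        specialize (Hstep (S n)). rewrite Rmult_plus_distr_l; lra. }
    assert (H0 : 0 < v (S n)) by apply exp_pos.
    apply Rmult_le_reg_l with d; [lra|].
    rewrite <- Rmult_assoc, Rinv_r, Rmult_1_l by lra.
    apply (Rle_trans _ _ _ H); lra.
Qed.

Lemma Cmod_equivalent_zeta (a : nat -> C) (n : nat) :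
  equivalent a zeta_coef -> (1 <= n)%nat -> Cmod (a n) = 1.
Proof.
  intros H Hn.
  destruct (H n Hn) as [psi [_ Hpsi]].
  assert (E := f_equal Cmod (Hpsi n ltac:(lia))).
  unfold zeta_coef in E.
  rewrite Cmod_mult, Cmod_Cexp, Cmod_1 in E.
  replace (Re (Ci * RtoC (psi (expo n)))%C) with 0 in E
    by (unfold Re; simpl; ring).
  rewrite exp_0 in E. lra.
Qed.

Lemma is_series_dirichlet_sum (a : nat -> C) (s : C) :
  (forall n, (1 <= n)%nat -> Cmod (a n) <= 1) -> 1 < Re s ->
  is_series (fun k => dirichlet_term a s (S k)) (dirichlet_sum a s).
Proof.
  intros Ha Hs.
  assert (Hb : forall k, Cmod (dirichlet_term a s (S k)) <= exp (expo (S k) * Re s)).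
  { intro k; unfold dirichlet_term.
    rewrite Cmod_mult, Cmod_Cexp.
    replace (Re (RtoC (expo (S k)) * s)%C) with (expo (S k) * Re s)
      by (unfold Re; simpl; ring).
    assert (H := exp_pos (expo (S k) * Re s)).
    assert (H' := Ha (S k) ltac:(lia)). nra. }
  assert (Hex := ex_series_inv_pow _ Hs).
  assert (Hm : forall k (z := dirichlet_term a s (S k)),
             Rabs (Re z) <= Cmod z /\ Rabs (Im z) <= Cmod z).
  { intros k z. generalize (Rmax_Cmod z); intro H; split;
      (eapply Rle_trans; [|exact H]); [apply Rmax_l|apply Rmax_r]. }
  assert (HR : ex_series (fun k => Re (dirichlet_term a s (S k)))).
  { apply (@ex_series_le _ R_CompleteNormedModule _ _
             (fun k => Rle_trans _ _ _ (proj1 (Hm k)) (Hb k)) Hex). }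
  assert (HI : ex_series (fun k => Im (dirichlet_term a s (S k)))).
  { apply (@ex_series_le _ R_CompleteNormedModule _ _
             (fun k => Rle_trans _ _ _ (proj2 (Hm k)) (Hb k)) Hex). }
  apply Series_correct in HR; apply Series_correct in HI.
  unfold is_series.
  assert (HS : forall n, sum_n (fun k => dirichlet_term a s (S k)) n
     = (sum_n (fun k => Re (dirichlet_term a s (S k))) n,
        sum_n (fun k => Im (dirichlet_term a s (S k))) n)).
  { induction n as [|n IH].
    - rewrite !sum_O. now destruct (dirichlet_term a s 1).
    - rewrite !sum_Sn, IH. reflexivity. }
  eapply filterlim_ext; [intro n; symmetry; apply HS|].
  intros P [eps HP].
  assert (HR' := proj1 (filterlim_locally _ _) HR eps).
  assert (HI' := proj1 (filterlim_locally _ _) HI eps).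
  destruct HR' as [n1 H1]; destruct HI' as [n2 H2].
  exists (max n1 n2); intros n Hn.
  apply HP; split; [apply H1 | apply H2]; lia.
Qed.

(* Main.v *)
Require Import Defs.
From Stdlib Require Import Reals.
From Coquelicot Require Import Coquelicot.
From Stdlib Require Import QArith Arith List Lia Lra Classical IndefiniteDescription.
Open Scope R_scope.

(** Equivalence with zeta forces the coefficients [a n] to be completely
    multiplicative and of modulus 1 ([equivalent_zeta_character]).  A vertical
    shift by [t] replaces the coefficient 1 of [n ^ (- s)] by [n ^ (- i t)].  So
    it is enough to find, for every [N], arbitrarily large [t] at which
    [n ^ (- i t)] is close to [a n] for all [n <= N] ([kronecker_log]): the terms
    with [n > N] contribute, on [Re s >= sigma1], at most twice the tail of
    the convergent series of the [n ^ (- sigma1)]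
    ([Cmod_dirichlet_sum_shift_le]), uniformly in [t] and [s].

    The approximation is a case of Kronecker's theorem, proved by Bohr's
    method in a form which needs neither primes nor linear independence of
    logarithms.  Let [chi_t n] be [n ^ (- i t) / a n], again a completely
    multiplicative function of modulus 1, and let [S t] be the sum of [chi_t]
    over a list [l] of positive integers that contains 1.  As [chi_t 1 = 1], if
    [|S t|] is nearly the length of [l], then every term is nearly 1.  To see
    that [|S t|] gets that large, raise it to the power [k]: by
    multiplicativity, [S t ^ k] is the sum of [chi_t] over the list of all
    products of [k] entries of [l].  The functions [chi_t m] and [chi_t n] of
    [t] are orthogonal in mean for [m <> n], because [log m <> log n], so the
    mean of [|S t| ^ (2 k)] is the number of coincidences between such products
    ([has_mean_Cmod2_Csum_twist]).  Since the products commute, only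
    polynomially many in [k] are distinct, and Cauchy-Schwarz gives at least
    [length l ^ (2 k) / (k + 1) ^ length l] coincidences ([energy_products]).
    The polynomial loss disappears under a [2 k]-th root
    ([Csum_twist_near_length]). *)

(** * Complex exponentials and unimodular characters *)

Lemma Cexp_plus (x y : C) : Cexp (x + y)%C = (Cexp x * Cexp y)%C.
Proof.
  destruct x as [a b]; destruct y as [c d].
  unfold Cexp, Cplus, Cmult; simpl.
  rewrite exp_plus, cos_plus, sin_plus. f_equal; ring.
Qed.

Lemma Cexp_Ci (x : R) : Cexp (Ci * RtoC x)%C = (cos x, sin x).
Proof.
  unfold Cexp; simpl.
  replace (0 * x - 1 * 0) with 0 by ring.
  replace (0 * 0 + 1 * x) with x by ring.
  rewrite exp_0. f_equal; ring.
Qed.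

Lemma Cmod_Cexp_Ci (x : R) : Cmod (Cexp (Ci * RtoC x)%C) = 1.
Proof.
  rewrite Cmod_Cexp.
  replace (Re (Ci * RtoC x)%C) with 0 by (simpl; ring).
  apply exp_0.
Qed.

Lemma expo_mult (m n : nat) :
  (1 <= m)%nat -> (1 <= n)%nat -> expo (m * n) = expo m + expo n.
Proof.
  intros Hm Hn. unfold expo.
  rewrite mult_INR, ln_mult by (apply lt_0_INR; lia). ring.
Qed.

Definition unimodular_character (a : nat -> C) : Prop :=
  (forall m n : nat, (1 <= m)%nat -> (1 <= n)%nat -> a (m * n)%nat = (a m * a n)%C) /\
  (forall n : nat, (1 <= n)%nat -> Cmod (a n) = 1).

Lemma unimodular_neq_0 (z : C) : Cmod z = 1 -> z <> RtoC 0.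
Proof. intros H ->. rewrite Cmod_0 in H. lra. Qed.

Lemma unimodular_character_1 (a : nat -> C) :
  unimodular_character a -> a 1%nat = RtoC 1.
Proof.
  intros [Hmul Hmod].
  assert (H := Hmul 1%nat 1%nat ltac:(lia) ltac:(lia)). simpl in H.
  assert (Hn := unimodular_neq_0 _ (Hmod 1%nat ltac:(lia))).
  rewrite <- (Cinv_r _ Hn). rewrite H at 2. field. exact Hn.
Qed.

Lemma VQ_expo (N n : nat) : (1 <= n <= N)%nat -> VQ N (expo n).
Proof.
  intros Hn.
  set (c := fun k => if Nat.eq_dec k n then 1%Q else 0%Q).
  exists c. set (f := fun k => _).
  assert (H : forall M, @eq R (sum_n_m f 1 M) (if le_dec n M then expo n else 0)).
  { induction M as [|M IH].
    - rewrite sum_n_m_zero by lia. destruct (le_dec n 0); [lia|reflexivity].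
    - rewrite sum_n_Sm by lia. rewrite IH. unfold f, c.
      change plus with Rplus.
      destruct (Nat.eq_dec (S M) n) as [E|E], (le_dec n M), (le_dec n (S M));
        try lia; rewrite ?RMicromega.Q2R_0, ?RMicromega.Q2R_1, ?E; ring. }
  rewrite H. destruct (le_dec n N); [reflexivity|lia].
Qed.

(** The phase of [a n] is additive in [expo n], and [expo] turns products
    into sums. *)
Lemma equivalent_zeta_character (a : nat -> C) :
  equivalent a zeta_coef -> unimodular_character a.
Proof.
  intros H. split; [|intros n; now apply Cmod_equivalent_zeta].
  intros m n Hm Hn.
  destruct (H (m * n)%nat ltac:(nia)) as [psi [[Hadd _] Hpsi]].
  assert (Em := Hpsi m ltac:(nia)).
  assert (En := Hpsi n ltac:(nia)).
  assert (Emn := Hpsi (m * n)%nat ltac:(nia)).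
  rewrite expo_mult, Hadd, RtoC_plus, Cmult_plus_distr_l, Cexp_plus in Emn
    by (assumption || (apply VQ_expo; nia)).
  unfold zeta_coef in *.
  set (u := Cexp _) in Em. set (v := Cexp _) in En. fold u v in Emn.
  assert (Huv : (u * v)%C <> RtoC 0).
  { apply unimodular_neq_0. unfold u, v.
    rewrite Cmod_mult, !Cmod_Cexp_Ci. ring. }
  assert (E : (a (m * n)%nat * (u * v) = a m * a n * (u * v))%C).
  { rewrite <- Emn. transitivity ((a m * u) * (a n * v))%C; [|ring].
    rewrite <- Em, <- En. ring. }
  rewrite <- (Cmult_1_r (a (m * n)%nat)), <- (Cmult_1_r (a m * a n)).
  rewrite <- (Cinv_r _ Huv), !Cmult_assoc.
  rewrite !Cmult_assoc in E. now rewrite E.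
Qed.

(** The phase error of [n ^ (- i t)] relative to [a n]. *)
Definition twist (a : nat -> C) (t : R) (n : nat) : C :=
  (/ a n * Cexp (Ci * RtoC (t * expo n)))%C.

Lemma twist_character (a : nat -> C) (t : R) :
  unimodular_character a -> unimodular_character (twist a t).
Proof.
  intros [Hmul Hmod]. unfold twist. split.
  - intros m n Hm Hn.
    rewrite expo_mult, Hmul, Rmult_plus_distr_l, RtoC_plus, Cmult_plus_distr_l,
      Cexp_plus by assumption.
    field. split; apply unimodular_neq_0, Hmod; assumption.
  - intros n Hn.
    rewrite Cmod_mult, Cmod_inv, Hmod, Cmod_Cexp_Ci by
      (try apply unimodular_neq_0, Hmod; assumption).
    field.
Qed.

(** * Mean values *)

(** A mean value in a strong form: the primitive of [f] stays within bounded
    distance of the linear function of slope [c].  It spares all integrals. *)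
Definition has_mean (f : R -> R) (c : R) : Prop :=
  exists (G : R -> R) (M : R),
    (forall t, is_derive G t (f t)) /\ (forall t, Rabs (G t - c * t) <= M).

Lemma has_mean_ext (f g : R -> R) (c : R) :
  (forall t, f t = g t) -> has_mean f c -> has_mean g c.
Proof.
  intros E (G & M & HG & HM). exists G, M. split; [|exact HM].
  intros t. rewrite <- E. apply HG.
Qed.

Lemma has_mean_const (c : R) : has_mean (fun _ => c) c.
Proof.
  exists (fun t => c * t), 0. split.
  - intros t. auto_derive; [trivial|ring].
  - intros t. rewrite Rminus_diag, Rabs_R0. lra.
Qed.

Lemma has_mean_plus (f g : R -> R) (c d : R) :
  has_mean f c -> has_mean g d -> has_mean (fun t => f t + g t) (c + d).
Proof.
  intros (F & M & HF & HM) (G & N & HG & HN).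
  exists (fun t => F t + G t), (M + N). split.
  - intros t. apply @is_derive_plus; auto.
  - intros t.
    replace (F t + G t - (c + d) * t) with ((F t - c * t) + (G t - d * t)) by ring.
    eapply Rle_trans; [apply Rabs_triang|]. now apply Rplus_le_compat.
Qed.

Lemma has_mean_oscillation (z : C) (mu : R) :
  mu <> 0 -> has_mean (fun t => Re (z * Cexp (Ci * RtoC (t * mu)))%C) 0.
Proof.
  intros Hmu. destruct z as [x y].
  apply has_mean_ext with (fun t => x * cos (t * mu) - y * sin (t * mu)).
  { intros t. rewrite Cexp_Ci. reflexivity. }
  exists (fun t => (x * sin (t * mu) + y * cos (t * mu)) / mu).
  exists ((Rabs x + Rabs y) * Rabs (/ mu)). split.
  - intros t. auto_derive; [trivial|]. field. exact Hmu.
  - intros t. rewrite Rmult_0_l, Rminus_0_r. unfold Rdiv.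
    rewrite Rabs_mult. apply Rmult_le_compat_r; [apply Rabs_pos|].
    eapply Rle_trans; [apply Rabs_triang|]. rewrite !Rabs_mult.
    assert (Hs : Rabs (sin (t * mu)) <= 1) by apply Rabs_le, SIN_bound.
    assert (Hc : Rabs (cos (t * mu)) <= 1) by apply Rabs_le, COS_bound.
    generalize (Rabs_pos x) (Rabs_pos y); intros. nra.
Qed.

(** On a long interval beyond [T], the mean value theorem bounds the growth of
    the primitive by [A] times the length, while it grows at rate [c]. *)
Lemma has_mean_le (f : R -> R) (c A T : R) :
  has_mean f c -> (forall t, T < t -> f t <= A) -> c <= A.
Proof.
  intros (G & M & HG & HM) HA.
  apply Rnot_lt_le. intros Hlt.
  assert (HM0 : 0 <= M) by (eapply Rle_trans; [apply Rabs_pos|apply (HM 0)]).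
  (* On an interval of this length the two rates differ by [2 * M + 1], more than
     the fluctuation [2 * M] allows. *)
  set (x := T + 1). set (y := x + (2 * M + 1) / (c - A)).
  assert (Hl : 0 < (2 * M + 1) / (c - A)) by (apply Rdiv_lt_0_compat; lra).
  destruct (MVT_gen G x y f) as (t & Ht & E).
  - intros; apply HG.
  - intros t _. apply derivable_continuous_pt.
    exists (f t). apply is_derive_Reals, HG.
  - rewrite Rmin_left, Rmax_right in Ht by (unfold y; lra).
    assert (Hft : f t <= A) by (apply HA; unfold x in Ht; lra).
    assert (Hx := proj1 (Rabs_le_between _ _) (HM x)).
    assert (Hy := proj1 (Rabs_le_between _ _) (HM y)).
    assert (Hprod : (c - A) * (y - x) = 2 * M + 1) by (unfold y; field; lra).
    assert (f t * (y - x) <= A * (y - x))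
      by (apply Rmult_le_compat_r; [unfold y|]; lra).
    nra.
Qed.

(** * Sums over lists *)

Definition Csum (f : nat -> C) (l : list nat) : C :=
  fold_right (fun n s => f n + s)%C (RtoC 0) l.

Definition Rsum (f : nat -> R) (l : list nat) : R :=
  fold_right (fun n s => f n + s) 0 l.

Lemma Csum_app (f : nat -> C) (l l' : list nat) :
  Csum f (l ++ l') = (Csum f l + Csum f l')%C.
Proof.
  induction l as [|n l IH]; simpl; [|rewrite IH]; ring.
Qed.

Lemma Cmod_Csum_le (f : nat -> C) (l : list nat) :
  (forall n, In n l -> Cmod (f n) = 1) -> Cmod (Csum f l) <= INR (length l).
Proof.
  induction l as [|n l IH]; intros H.
  - simpl. rewrite Cmod_0. lra.
  - cbn [Csum fold_right length]. rewrite S_INR.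
    eapply Rle_trans; [apply Cmod_triangle|].
    rewrite H by (now left).
    assert (IH' := IH (fun k Hk => H k (or_intror Hk))).
    unfold Csum in IH'. lra.
Qed.

Lemma Rsum_ext (f g : nat -> R) (l : list nat) :
  (forall n, f n = g n) -> Rsum f l = Rsum g l.
Proof.
  intros H. induction l as [|n l IH]; simpl; [|rewrite IH, H]; reflexivity.
Qed.

Lemma Rsum_plus (f g : nat -> R) (l : list nat) :
  Rsum (fun n => f n + g n) l = Rsum f l + Rsum g l.
Proof. induction l as [|n l IH]; simpl; [|rewrite IH]; ring. Qed.

Lemma Rsum_scal (c : R) (f : nat -> R) (l : list nat) :
  Rsum (fun n => c * f n) l = c * Rsum f l.
Proof. induction l as [|n l IH]; simpl; [|rewrite IH]; ring. Qed.

Lemma Rsum_const (c : R) (l : list nat) :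
  Rsum (fun _ => c) l = INR (length l) * c.
Proof.
  induction l as [|n l IH]; cbn [Rsum fold_right length]; [simpl; ring|].
  rewrite S_INR. unfold Rsum in IH. rewrite IH. ring.
Qed.

Lemma Rsum_nonneg (f : nat -> R) (l : list nat) :
  (forall n, 0 <= f n) -> 0 <= Rsum f l.
Proof.
  intros H. induction l as [|n l IH]; simpl; [|specialize (H n)]; lra.
Qed.

Lemma Rsum_indicator (x : R) (m : nat) (l : list nat) :
  NoDup l -> In m l -> Rsum (fun d => if Nat.eq_dec m d then x else 0) l = x.
Proof.
  intros Hl. induction Hl as [|n l Hn Hl IH]; intros Hm; [destruct Hm|].
  cbn [Rsum fold_right]. fold (Rsum (fun d => if Nat.eq_dec m d then x else 0) l).
  destruct (Nat.eq_dec m n) as [<-|Hmn].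
  - replace (Rsum _ l) with 0; [ring|].
    clear - Hn. induction l as [|k l IH]; [reflexivity|].
    cbn [Rsum fold_right]. fold (Rsum (fun d => if Nat.eq_dec m d then x else 0) l).
    rewrite <- IH by (intro; apply Hn; now right).
    destruct (Nat.eq_dec m k) as [<-|]; [exfalso; apply Hn; now left|ring].
  - destruct Hm as [->|Hm]; [congruence|]. rewrite IH by assumption. ring.
Qed.

Lemma Rsum_count_occ (g : nat -> R) (l u : list nat) :
  NoDup u -> incl l u ->
  Rsum (fun d => g d * INR (count_occ Nat.eq_dec l d)) u = Rsum g l.
Proof.
  intros Hu. induction l as [|m l IH]; intros Hl.
  - rewrite (Rsum_ext _ (fun _ => 0)) by (intro; simpl; ring).
    rewrite Rsum_const. simpl. ring.
  - rewrite (Rsum_ext _ (fun d => (if Nat.eq_dec m d then g m else 0)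
                     + g d * INR (count_occ Nat.eq_dec l d))).
    + rewrite Rsum_plus, IH, Rsum_indicator.
      * reflexivity.
      * exact Hu.
      * apply Hl. now left.
      * intros k Hk. apply Hl. now right.
    + intros d. cbn [count_occ].
      destruct (Nat.eq_dec m d) as [<-|]; [rewrite S_INR|]; ring.
Qed.

(** The pairs of positions of [l] with equal entries are counted because they
    give the cross terms of [|Csum (twist a t) l| ^ 2] that survive averaging
    over [t]. *)
Definition energy (l : list nat) : R :=
  Rsum (fun m => INR (count_occ Nat.eq_dec l m)) l.

(** Cauchy-Schwarz for the multiplicities [c d]: expand the sum over [d] in [u]
    of the squares of [length u * c d - length l]. *)
Lemma energy_lower_bound (l u : list nat) :
  NoDup u -> incl l u -> INR (length l) ^ 2 <= INR (length u) * energy l.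
Proof.
  intros Hu Hl.
  set (c := fun d => INR (count_occ Nat.eq_dec l d)).
  set (D := INR (length u)). set (L := INR (length l)).
  assert (HD : 0 <= D) by apply pos_INR.
  assert (H1 : Rsum c u = L).
  { rewrite (Rsum_ext _ (fun d => 1 * INR (count_occ Nat.eq_dec l d)))
      by (intro; unfold c; ring).
    rewrite (Rsum_count_occ (fun _ => 1)) by assumption.
    rewrite Rsum_const. unfold L. ring. }
  assert (H2 : Rsum (fun d => c d * c d) u = energy l)
    by (apply (Rsum_count_occ c); assumption).
  assert (H0 : 0 <= Rsum (fun d => (D * c d - L) ^ 2) u)
    by (apply Rsum_nonneg; intro; apply pow2_ge_0).
  rewrite (Rsum_ext _ (fun d => (D ^ 2 * (c d * c d)) + ((- 2 * D * L) * c d + L ^ 2)))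
    in H0 by (intro; ring).
  rewrite !Rsum_plus, !Rsum_scal, Rsum_const, H1, H2 in H0. fold D in H0.
  (* For an empty [u] nothing can be divided out, but then [l] is empty too. *)
  destruct HD as [HD|HD].
  - apply Rmult_le_reg_l with D; nra.
  - assert (length u = 0%nat) by (apply INR_eq; symmetry; exact HD).
    assert (u = nil) as -> by (now apply length_zero_iff_nil).
    assert (l = nil) as -> by (now apply incl_l_nil).
    unfold L, D. simpl. lra.
Qed.

Lemma Re_Csum_mult_conj (f g : nat -> C) (l l' : list nat) :
  Re (Csum f l * Cconj (Csum g l'))%C
  = Rsum (fun m => Rsum (fun n => Re (f m * Cconj (g n))%C) l') l.
Proof.
  assert (H : forall z, Re (z * Cconj (Csum g l'))%C
                        = Rsum (fun n => Re (z * Cconj (g n))%C) l').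
  { intros z. induction l' as [|n l' IH]; [simpl; ring|].
    cbn [Csum Rsum fold_right]. fold (Csum g l').
    rewrite Cplus_conj, Cmult_plus_distr_l, re_plus, IH. reflexivity. }
  induction l as [|m l IH]; [simpl; ring|].
  cbn [Csum Rsum fold_right]. fold (Csum f l).
  rewrite Cmult_plus_distr_r, re_plus, IH, H. reflexivity.
Qed.

Lemma has_mean_Rsum (f : nat -> R -> R) (c : nat -> R) (l : list nat) :
  (forall n, In n l -> has_mean (f n) (c n)) ->
  has_mean (fun t => Rsum (fun n => f n t) l) (Rsum c l).
Proof.
  induction l as [|n l IH]; intros H; [exact (has_mean_const 0)|].
  apply (has_mean_plus (f n) (fun t => Rsum (fun n => f n t) l)).
  - apply H. now left.
  - apply IH. intros k Hk. apply H. now right.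
Qed.

Lemma Rsum_indicator_count (m : nat) (l : list nat) :
  Rsum (fun n => if Nat.eq_dec n m then 1 else 0) l
  = INR (count_occ Nat.eq_dec l m).
Proof.
  induction l as [|n l IH]; [reflexivity|].
  cbn [Rsum fold_right count_occ]. unfold Rsum in IH. rewrite IH.
  destruct (Nat.eq_dec n m); [rewrite S_INR|]; ring.
Qed.

Lemma expo_inj (m n : nat) :
  (1 <= m)%nat -> (1 <= n)%nat -> expo m = expo n -> m = n.
Proof.
  intros Hm Hn E. unfold expo in E.
  apply INR_eq, ln_inv; [apply lt_0_INR; lia ..|lra].
Qed.

(** The cross term of [m] and [n] oscillates with frequency
    [expo m - expo n], which vanishes only for [m = n]. *)
Lemma has_mean_twist_correlation (a : nat -> C) (m n : nat) :
  unimodular_character a -> (1 <= m)%nat -> (1 <= n)%nat ->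
  has_mean (fun t => Re (twist a t m * Cconj (twist a t n))%C)
    (if Nat.eq_dec n m then 1 else 0).
Proof.
  intros Ha Hm Hn. destruct (Nat.eq_dec n m) as [->|Hmn].
  - apply has_mean_ext with (fun _ => 1); [|apply has_mean_const].
    intros t. rewrite <- Cmod2_conj.
    rewrite (proj2 (twist_character a t Ha) m Hm). simpl. ring.
  - apply has_mean_ext with (fun t =>
      Re ((/ a m * Cconj (/ a n)) * Cexp (Ci * RtoC (t * (expo m - expo n))))%C).
    + intros t. f_equal. unfold twist. rewrite Cmult_conj.
      transitivity ((/ a m * Cconj (/ a n)) *
        (Cexp (Ci * RtoC (t * expo m)) * Cconj (Cexp (Ci * RtoC (t * expo n)))))%C;
        [f_equal|ring].
      rewrite !Cexp_Ci. unfold Cconj, Cmult; simpl.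
      rewrite Rmult_minus_distr_l, cos_minus, sin_minus. f_equal; ring.
    + apply has_mean_oscillation.
      intros E. apply Hmn, expo_inj; [assumption ..|lra].
Qed.

Lemma has_mean_Cmod2_Csum_twist (a : nat -> C) (l : list nat) :
  unimodular_character a -> (forall n, In n l -> (1 <= n)%nat) ->
  has_mean (fun t => Cmod (Csum (twist a t) l) ^ 2) (energy l).
Proof.
  intros Ha Hl.
  apply has_mean_ext with (fun t =>
    Rsum (fun m => Rsum (fun n => Re (twist a t m * Cconj (twist a t n))%C) l) l).
  { intros t. rewrite <- Re_Csum_mult_conj, <- Cmod2_conj. reflexivity. }
  apply (has_mean_Rsum (fun m t =>
    Rsum (fun n => Re (twist a t m * Cconj (twist a t n))%C) l)).
  intros m Hm. rewrite <- Rsum_indicator_count.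
  apply (has_mean_Rsum (fun n t => Re (twist a t m * Cconj (twist a t n))%C)).
  intros n Hn. apply has_mean_twist_correlation; auto.
Qed.

(** * Products of integers *)

(** Multiplicities are kept, so that summing a character over the list gives a
    [k]-th power ([Csum_products]). *)
Fixpoint products (l : list nat) (k : nat) : list nat :=
  match k with
  | O => 1%nat :: nil
  | S k => flat_map (fun n => map (Nat.mul n) (products l k)) l
  end.

Lemma products_pos (l : list nat) (k : nat) :
  (forall n, In n l -> (1 <= n)%nat) ->
  forall m, In m (products l k) -> (1 <= m)%nat.
Proof.
  intros Hl. induction k as [|k IH]; simpl; intros m Hm.
  - destruct Hm as [<-|[]]. lia.
  - apply in_flat_map in Hm as (n & Hn & Hm).
    apply in_map_iff in Hm as (p & <- & Hp).
    specialize (Hl n Hn). specialize (IH p Hp). nia.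
Qed.

Lemma length_products (l : list nat) (k : nat) :
  length (products l k) = (length l ^ k)%nat.
Proof.
  induction k as [|k IH]; [reflexivity|].
  cbn [products]. rewrite (flat_map_constant_length (c := (length l ^ k)%nat)).
  - simpl. lia.
  - intros n _. rewrite length_map. exact IH.
Qed.

Lemma Csum_products (chi : nat -> C) (l : list nat) (k : nat) :
  unimodular_character chi -> (forall n, In n l -> (1 <= n)%nat) ->
  Csum chi (products l k) = (Csum chi l ^ k)%C.
Proof.
  intros Hchi Hl. induction k as [|k IH].
  - simpl. rewrite (unimodular_character_1 chi Hchi). ring.
  - cbn [products Cpow]. rewrite <- IH.
    assert (Hp := products_pos l k Hl).
    set (p := products l k) in *. clearbody p.
    assert (Hmul : forall n, (1 <= n)%nat ->
              Csum chi (map (Nat.mul n) p) = (chi n * Csum chi p)%C).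
    { intros n Hn. clear IH. induction p as [|m p IHp]; [simpl; ring|].
      cbn [map Csum fold_right]. fold (Csum chi p).
      fold (Csum chi (map (Nat.mul n) p)).
      rewrite IHp by (intros; apply Hp; now right).
      rewrite (proj1 Hchi) by (exact Hn || (apply Hp; now left)). ring. }
    clear IH. induction l as [|n l IHl]; [simpl; ring|].
    cbn [flat_map]. rewrite Csum_app, Hmul by (apply Hl; now left).
    rewrite IHl by (intros; apply Hl; now right).
    simpl. ring.
Qed.

(** A list of polynomial length in [k] that contains every product of [k]
    entries of [l]. *)
Fixpoint power_box (k : nat) (l : list nat) : list nat :=
  match l with
  | nil => 1%nat :: nil
  | n :: l => flat_map (fun e => map (Nat.mul (n ^ e)) (power_box k l)) (seq 0 (S k))
  end.

Lemma length_power_box (k : nat) (l : list nat) :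
  length (power_box k l) = (S k ^ length l)%nat.
Proof.
  induction l as [|n l IH]; [reflexivity|].
  cbn [power_box]. rewrite (flat_map_constant_length (c := (S k ^ length l)%nat)).
  - rewrite length_seq. reflexivity.
  - intros e _. rewrite length_map. exact IH.
Qed.

Lemma in_power_box_cons (k n m : nat) (l : list nat) :
  In m (power_box k (n :: l)) <->
  exists e p, (e <= k)%nat /\ In p (power_box k l) /\ m = (n ^ e * p)%nat.
Proof.
  cbn [power_box]. rewrite in_flat_map. split.
  - intros (e & He & Hm). apply in_seq in He.
    apply in_map_iff in Hm as (p & <- & Hp). exists e, p. repeat split; trivial; lia.
  - intros (e & p & He & Hp & ->). exists e. split; [apply in_seq; lia|].
    now apply in_map.
Qed.

Lemma power_box_incr (k : nat) (l : list nat) :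
  incl (power_box k l) (power_box (S k) l).
Proof.
  induction l as [|n l IH]; [apply incl_refl|].
  intros m Hm. apply in_power_box_cons in Hm as (e & p & He & Hp & ->).
  apply in_power_box_cons. exists e, p. auto.
Qed.

Lemma mul_in_power_box (k n m : nat) (l : list nat) :
  In n l -> In m (power_box k l) -> In (n * m)%nat (power_box (S k) l).
Proof.
  revert m. induction l as [|x l IH]; intros m Hn Hm; [destruct Hn|].
  apply in_power_box_cons in Hm as (e & p & He & Hp & ->).
  apply in_power_box_cons. destruct Hn as [->|Hn].
  - exists (S e), p. repeat split; [lia|now apply power_box_incr|simpl; ring].
  - exists e, (n * p)%nat. repeat split; [lia|now apply IH|ring].
Qed.

Lemma products_in_power_box (l : list nat) (k : nat) :
  incl (products l k) (power_box k l).
Proof.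
  induction k as [|k IH]; intros m Hm.
  - simpl in Hm. destruct Hm as [<-|[]]. induction l as [|n l IH]; [now left|].
    apply in_power_box_cons. exists 0%nat, 1%nat. auto.
  - cbn [products] in Hm. apply in_flat_map in Hm as (n & Hn & Hm).
    apply in_map_iff in Hm as (p & <- & Hp). apply mul_in_power_box; auto.
Qed.

(** There are [length l ^ k] products, but each is determined by how often each
    entry of [l] occurs in it, so at most [(k + 1) ^ length l] are distinct. *)
Lemma energy_products (l : list nat) (k : nat) :
  (INR (length l) ^ 2) ^ k <= INR (S k) ^ length l * energy (products l k).
Proof.
  set (u := nodup Nat.eq_dec (products l k)).
  assert (Hu : (length u <= S k ^ length l)%nat).
  { rewrite <- length_power_box. apply NoDup_incl_length; [apply NoDup_nodup|].
    intros m Hm. apply nodup_In in Hm. now apply products_in_power_box. }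
  assert (H : INR (length (products l k)) ^ 2 <= INR (length u) * energy (products l k)).
  { apply energy_lower_bound; [apply NoDup_nodup|].
    intros m Hm. now apply nodup_In. }
  rewrite length_products, pow_INR in H.
  rewrite <- pow_mult, Nat.mul_comm, pow_mult.
  eapply Rle_trans; [exact H|]. apply Rmult_le_compat_r.
  - apply Rsum_nonneg. intros; apply pos_INR.
  - rewrite <- pow_INR. now apply le_INR.
Qed.

(** * Simultaneous approximation *)

(** By induction on [N]: a square root of [q] pays for each factor [k + 1]. *)
Lemma poly_geom_bounded (N : nat) (q : R) :
  0 <= q < 1 -> exists M, forall k, INR (S k) ^ N * q ^ k <= M.
Proof.
  revert q. induction N as [|N IH]; intros q Hq.
  - exists 1. intros k. rewrite pow_O, Rmult_1_l, <- (pow1 k). apply pow_incr. lra.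
  - set (r := sqrt q).
    assert (Hr0 : 0 <= r) by apply sqrt_pos.
    assert (Hrr : r * r = q) by (apply sqrt_sqrt; lra).
    assert (Hr1 : r < 1) by nra.
    destruct (IH r (conj Hr0 Hr1)) as [M HM].
    assert (Hk : forall k, INR (S k) * r ^ k <= / (1 - r)).
    { intros k. apply Rmult_le_reg_l with (1 - r); [lra|].
      rewrite Rinv_r by lra.
      (* [(1 - r) * (1 + r + ... + r ^ k)] is [1 - r ^ S k], and each of its
         [k + 1] powers of [r] is at least [r ^ k]. *)
      apply Rle_trans with (1 - r ^ S k).
      - induction k as [|k IHk]; [simpl; lra|].
        assert (Hp : 0 <= r ^ S k <= 1).
        { split; [now apply pow_le|]. rewrite <- (pow1 (S k)). apply pow_incr. lra. }
        rewrite S_INR. simpl pow in *. nra.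
      - assert (0 <= r ^ S k) by now apply pow_le. lra. }
    exists (M * / (1 - r)). intros k.
    replace (INR (S k) ^ S N * q ^ k)
      with ((INR (S k) ^ N * r ^ k) * (INR (S k) * r ^ k))
      by (rewrite <- Hrr, Rpow_mult_distr, <- (tech_pow_Rmult (INR (S k)) N); ring).
    apply Rmult_le_compat; auto;
      apply Rmult_le_pos; try apply pow_le; auto using pos_INR.
Qed.

Lemma poly_geom_lt (N : nat) (x y : R) :
  0 <= x < y -> exists k, INR (S k) ^ N * x ^ k < y ^ k.
Proof.
  intros Hxy. set (q := x / y).
  assert (Hq : 0 <= q < 1).
  { unfold q. split; [apply Rdiv_le_0_compat; lra|].
    apply Rmult_lt_reg_r with y; [lra|]. field_simplify; lra. }
  (* One power of [k + 1] more than needed turns boundedness into decay. *)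
  destruct (poly_geom_bounded (S N) q Hq) as [M HM].
  destruct (INR_unbounded M) as [k Hk]. exists k.
  assert (Hy : 0 < y ^ k) by (apply pow_lt; lra).
  replace (x ^ k) with (q ^ k * y ^ k)
    by (unfold q; rewrite <- Rpow_mult_distr; f_equal; field; lra).
  rewrite <- Rmult_assoc. rewrite <- (Rmult_1_l (y ^ k)) at 2.
  apply Rmult_lt_compat_r; [exact Hy|].
  apply Rmult_lt_reg_l with (INR (S k)); [apply lt_0_INR; lia|].
  specialize (HM k). rewrite <- tech_pow_Rmult in HM.
  rewrite <- Rmult_assoc, Rmult_1_r. rewrite S_INR in *. lra.
Qed.

(** If [Csum (twist a t) l] stayed below [length l - delta] beyond [T], the mean
    of the [2 k]-th power of its modulus, which is [energy (products l k)],
    would be exponentially smaller than [length l ^ (2 k)], against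
    [energy_products]. *)
Lemma Csum_twist_near_length (a : nat -> C) (l : list nat) (delta T : R) :
  unimodular_character a -> (forall n, In n l -> (1 <= n)%nat) -> 0 < delta ->
  exists t, T < t /\ INR (length l) - delta < Cmod (Csum (twist a t) l).
Proof.
  intros Ha Hl Hdelta. apply NNPP. intros Hno.
  assert (Hle : forall t, T < t -> Cmod (Csum (twist a t) l) <= INR (length l) - delta).
  { intros t Ht. apply Rnot_lt_le. intros H. apply Hno. now exists t. }
  set (L := INR (length l)) in *.
  assert (HL : 0 <= L - delta)
    by (eapply Rle_trans; [apply Cmod_ge_0|apply (Hle (T + 1)); lra]).
  destruct (poly_geom_lt (length l) ((L - delta) ^ 2) (L ^ 2)) as [k Hk];
    [split; nra|].
  assert (HE : energy (products l k) <= ((L - delta) ^ 2) ^ k).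
  { apply has_mean_le with (fun t => Cmod (Csum (twist a t) (products l k)) ^ 2) T.
    - apply has_mean_Cmod2_Csum_twist; [assumption|now apply products_pos].
    - intros t Ht.
      rewrite Csum_products, Cmod_pow by (try apply twist_character; assumption).
      rewrite <- pow_mult, Nat.mul_comm, pow_mult.
      apply pow_incr. split; [apply pow2_ge_0|].
      apply pow_incr. split; [apply Cmod_ge_0|auto]. }
  assert (H := energy_products l k). fold L in H.
  assert (HS : 0 <= INR (S k) ^ length l) by apply pow_le, pos_INR.
  assert (H' := Rmult_le_compat_l _ _ _ HS HE). lra.
Qed.

(** By the parallelogram law, [|z - 1| ^ 2 + |1 + z| ^ 2 = 4] on the unit
    circle. *)
Lemma unimodular_near_1 (z : C) (delta : R) :
  Cmod z = 1 -> delta <= 2 -> 2 - delta <= Cmod (1 + z)%C ->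
  Cmod (z - 1)%C ^ 2 <= 4 * delta.
Proof.
  intros Hz Hd H.
  assert (E : Cmod (z - 1)%C ^ 2 + Cmod (1 + z)%C ^ 2 = 2 + 2 * Cmod z ^ 2).
  { rewrite !Cmod2_alt. destruct z as [x y]. simpl. ring. }
  rewrite Hz in E. nra.
Qed.

(** Bohr's trick: the list is enlarged by the entry [1], at which every
    character is [1].  A sum of unimodular numbers of nearly maximal modulus
    has nearly parallel terms, so all of them are near [1]. *)
Lemma kronecker_log (a : nat -> C) (l : list nat) (eps T : R) :
  unimodular_character a -> (forall n, In n l -> (1 <= n)%nat) -> 0 < eps ->
  exists t, T < t /\
    forall n, In n l -> Cmod (Cexp (Ci * RtoC (t * expo n)) - a n)%C < eps.
Proof.
  intros Ha Hl Heps.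
  (* [unimodular_near_1] gives the error [2 * sqrt delta], which is below [eps];
     it needs [delta <= 2]. *)
  set (delta := Rmin 2 (eps ^ 2 / 8)).
  assert (He2 : 0 < eps ^ 2) by (apply pow_lt; exact Heps).
  assert (Hd : 0 < delta) by (apply Rmin_glb_lt; lra).
  destruct (Csum_twist_near_length a (1%nat :: l) delta T Ha) as (t & Ht & Hsum).
  - intros n [<-|Hn]; auto.
  - exact Hd.
  - exists t. split; [exact Ht|]. intros n Hn.
    assert (Hchi := twist_character a t Ha).
    set (chi := twist a t) in *.
    assert (Hz : Cmod (chi n) = 1) by (apply Hchi; auto).
    destruct (in_split n l Hn) as (l1 & l2 & ->).
    assert (Hrest : Cmod (Csum chi (l1 ++ l2)) <= INR (length (l1 ++ l2))).
    { apply Cmod_Csum_le. intros m Hm. apply Hchi, Hl.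
      apply in_app_iff in Hm as [|]; apply in_app_iff; [left|right; right]; assumption. }
    assert (E : Csum chi (1%nat :: l1 ++ n :: l2)
                = ((1 + chi n) + Csum chi (l1 ++ l2))%C).
    { cbn [Csum fold_right]. fold (Csum chi (l1 ++ n :: l2)).
      rewrite (unimodular_character_1 chi Hchi), !Csum_app.
      cbn [Csum fold_right]. fold (Csum chi l2). ring. }
    rewrite E in Hsum.
    assert (Htri := Cmod_triangle (1 + chi n)%C (Csum chi (l1 ++ l2))).
    assert (Hlen : length (1%nat :: l1 ++ n :: l2) = S (S (length (l1 ++ l2)))).
    { simpl. rewrite !length_app. simpl. lia. }
    rewrite Hlen, !S_INR in Hsum.
    assert (H4 : Cmod (chi n - 1)%C ^ 2 <= 4 * delta).
    { apply unimodular_near_1; [exact Hz|apply Rmin_l|lra]. }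
    assert (Hdr : delta <= eps ^ 2 / 8) by apply Rmin_r.
    assert (Hne : a n <> RtoC 0) by (apply unimodular_neq_0, Ha; auto).
    replace (Cexp (Ci * RtoC (t * expo n)) - a n)%C with (a n * (chi n - 1))%C
      by (unfold chi, twist; field; exact Hne).
    rewrite Cmod_mult, (proj2 Ha) by auto.
    rewrite Rmult_1_l.
    assert (H0 := Cmod_ge_0 (chi n - 1)%C). nra.
Qed.

(** A diagonal choice: each shift is taken beyond its predecessor by more than 1,
    which makes the sequence unbounded, and handles one more coefficient with a
    better precision. *)
Lemma exists_shifts (a : nat -> C) :
  unimodular_character a ->
  exists tau : nat -> R,
    (forall n, INR n < tau n) /\
    (forall n, tau n < tau (S n)) /\
    (forall n m, (1 <= m <= n)%nat ->
       Cmod (Cexp (Ci * RtoC (tau n * expo m)) - a m)%C < / INR (S n)).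
Proof.
  intros Ha.
  assert (H : forall n T, {t | T < t /\ forall m, In m (seq 1 n) ->
      Cmod (Cexp (Ci * RtoC (t * expo m)) - a m)%C < / INR (S n)}).
  { intros n T. apply constructive_indefinite_description.
    apply kronecker_log; [exact Ha| |].
    - intros m Hm. apply in_seq in Hm. lia.
    - apply Rinv_0_lt_compat, lt_0_INR. lia. }
  set (tau := fix tau n := match n with
              | O => proj1_sig (H O 0)
              | S n => proj1_sig (H (S n) (tau n + 1))
              end).
  assert (Hstep : forall n, tau n + 1 < tau (S n)).
  { intros n. cbn [tau]. exact (proj1 (proj2_sig (H (S n) (tau n + 1)))). }
  exists tau. repeat split.
  - induction n as [|n IH].
    + exact (proj1 (proj2_sig (H O 0))).
    + specialize (Hstep n). rewrite S_INR. lra.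
  - intros n. specialize (Hstep n). lra.
  - intros n m Hm. assert (Hin : In m (seq 1 n)) by (apply in_seq; lia).
    destruct n as [|n].
    + exact (proj2 (proj2_sig (H O 0)) m Hin).
    + exact (proj2 (proj2_sig (H (S n) (tau n + 1))) m Hin).
Qed.

(** * Uniform convergence *)

Lemma Cmod_is_series_le (u : nat -> C) (b : nat -> R) (l : C) (B : R) :
  is_series u l -> (forall k, Cmod (u k) <= b k) -> (forall n, sum_n b n <= B) ->
  Cmod l <= B.
Proof.
  intros Hu Hb HB.
  assert (Hlim : is_lim_seq (fun n => Cmod (sum_n u n)) (Cmod l)).
  { apply (filterlim_comp _ _ _ _ _ _ _ _ Hu).
    exact (@filterlim_norm C_AbsRing C_NormedModule l). }
  assert (Hle : forall n, Cmod (sum_n u n) <= B).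
  { intros n. apply Rle_trans with (sum_n b n); [|apply HB].
    induction n as [|n IH].
    - rewrite !sum_O. apply Hb.
    - rewrite !sum_Sn. eapply Rle_trans; [apply Cmod_triangle|].
      apply Rplus_le_compat; [exact IH|apply Hb]. }
  exact (is_lim_seq_le _ _ _ _ Hle Hlim (is_lim_seq_const B)).
Qed.

(** The weights are the bounds for the coefficient errors: [eta] where the
    approximation is controlled, and 2, the diameter of the unit circle,
    beyond. *)
Lemma sum_n_head_tail (w : nat -> R) (W eta : R) (K n : nat) :
  (forall k, 0 <= w k) -> (forall j, sum_n w j <= W) -> 0 <= eta ->
  sum_n (fun k => (if le_dec k K then eta else 2) * w k) n
  <= eta * W + 2 * (W - sum_n w K).
Proof.
  intros Hw HW Heta.
  assert (H : sum_n (fun k => (if le_dec k K then eta else 2) * w k) n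
              <= eta * sum_n w n + 2 * (sum_n w (max n K) - sum_n w K)).
  { induction n as [|n IH].
    - rewrite Nat.max_0_l, !sum_O. destruct (le_dec 0 K); [lra|lia].
    - rewrite !sum_Sn. change plus with Rplus.
      assert (Hn := Hw (S n)).
      destruct (le_dec (S n) K).
      + rewrite Nat.max_r in * by lia. lra.
      + rewrite (Nat.max_l (S n)) by lia. rewrite Nat.max_l in IH by lia.
        rewrite sum_Sn. change plus with Rplus. nra. }
  assert (H1 := HW n). assert (H2 := HW (max n K)). nra.
Qed.

Lemma sum_n_le_Series (w : nat -> R) (n : nat) :
  (forall k, 0 <= w k) -> ex_series w -> sum_n w n <= Series w.
Proof.
  intros Hw Hex.
  apply (is_lim_seq_incr_compare (sum_n w)).
  - apply Series_correct in Hex. exact Hex.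
  - intros k. rewrite sum_Sn. change plus with Rplus. specialize (Hw (S k)). lra.
Qed.

(** Term by term, the difference is the coefficient error times [n ^ (- s)],
    whose modulus is at most [n ^ (- sigma)]. *)
Lemma Cmod_dirichlet_sum_shift_le (a : nat -> C) (t sigma eta : R) (K : nat) (s : C) :
  unimodular_character a -> 1 < sigma -> sigma <= Re s -> 0 <= eta ->
  (forall m, (1 <= m <= S K)%nat ->
     Cmod (Cexp (Ci * RtoC (t * expo m)) - a m)%C <= eta) ->
  let w := fun k => exp (expo (S k) * sigma) in
  Cmod (zeta (s + Ci * RtoC t) - dirichlet_sum a s)%C
  <= eta * Series w + 2 * (Series w - sum_n w K).
Proof.
  intros Ha Hsigma Hs Heta Hm w.
  assert (Hw : forall k, 0 <= w k) by (intro; apply Rlt_le, exp_pos).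
  assert (Hz : is_series (fun k => dirichlet_term zeta_coef (s + Ci * RtoC t)%C (S k))
                 (zeta (s + Ci * RtoC t)%C)).
  { apply is_series_dirichlet_sum.
    - intros n _. unfold zeta_coef. rewrite Cmod_1. lra.
    - replace (Re (s + Ci * RtoC t)%C) with (Re s) by (unfold Re; simpl; ring). lra. }
  assert (Hf : is_series (fun k => dirichlet_term a s (S k)) (dirichlet_sum a s)).
  { apply is_series_dirichlet_sum; [|lra].
    intros n Hn. rewrite (proj2 Ha) by exact Hn. lra. }
  apply (Cmod_is_series_le _ (fun k => (if le_dec k K then eta else 2) * w k) _ _
           (is_series_minus _ _ _ _ Hz Hf)).
  - intros k. set (x := expo (S k)).
    replace (plus _ _)
      with (Cexp (RtoC x * s) * (Cexp (Ci * RtoC (t * x)) - a (S k)))%C.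
    + rewrite Cmod_mult, Rmult_comm, Cmod_Cexp.
      apply Rmult_le_compat; [apply Cmod_ge_0|apply Rlt_le, exp_pos| |].
      * destruct (le_dec k K); [apply Hm; lia|].
        eapply Rle_trans; [apply Cmod_triangle|].
        rewrite Cmod_opp, Cmod_Cexp_Ci, (proj2 Ha) by lia. lra.
      * assert (Hx : x <= 0).
        { unfold x, expo.
          assert (0 <= ln (INR (S k))); [|lra].
          rewrite <- ln_1. apply ln_le; [lra|]. rewrite S_INR.
          generalize (pos_INR k). lra. }
        replace (Re (RtoC x * s)%C) with (x * Re s) by (unfold Re; simpl; ring).
        unfold w. fold x. destruct (Rle_lt_or_eq_dec (x * Re s) (x * sigma)) as [H|H].
        -- nra.
        -- apply Rlt_le, exp_increasing, H.
        -- rewrite H. lra.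
    + unfold dirichlet_term, zeta_coef. fold x.
      change plus with Cplus. change opp with Copp.
      replace (RtoC x * (s + Ci * RtoC t))%C
        with (RtoC x * s + Ci * RtoC (t * x))%C by (rewrite RtoC_mult; ring).
      rewrite Cexp_plus. ring.
  - intros n. apply sum_n_head_tail; trivial.
    intros j. apply sum_n_le_Series; [exact Hw|now apply ex_series_inv_pow].
Qed.

Theorem theorem6 (a : nat -> C) (ha : equivalent a zeta_coef) :
  exists tau : nat -> R,
    (forall n : nat, 0 < tau n) /\
    (forall n : nat, tau n < tau (S n)) /\
    (forall M : R, exists n : nat, M < tau n) /\
    (forall sigma1 sigma2 : R, 1 < sigma1 -> sigma1 < sigma2 ->
       converges_uniformly_on (strip sigma1 sigma2)
         (fun n s => zeta (s + Ci * RtoC (tau n))%C)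
         (dirichlet_sum a)).
Proof.
  apply equivalent_zeta_character in ha.
  destruct (exists_shifts a ha) as (tau & Hlarge & Hincr & Happrox).
  exists tau. repeat split.
  - intros n. eapply Rle_lt_trans; [apply (pos_INR n)|apply Hlarge].
  - exact Hincr.
  - intros M. destruct (INR_unbounded M) as [n Hn]. exists n.
    specialize (Hlarge n). lra.
  - intros sigma1 sigma2 H1 _ eps Heps.
    set (w := fun k => exp (expo (S k) * sigma1)).
    assert (Hex : ex_series w) by now apply ex_series_inv_pow.
    assert (HW : 0 < Series w).
    { apply Rlt_le_trans with (sum_n w 0).
      - rewrite sum_O. apply exp_pos.
      - apply sum_n_le_Series; [intro; apply Rlt_le, exp_pos|exact Hex]. }
    assert (Hlim : is_lim_seq (sum_n w) (Series w)) by apply (Series_correct _ Hex).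
    assert (He4 : 0 < eps / 4) by lra.
    (* Half of [eps] goes to twice the tail beyond [K], the other half to the
       head, where the precision [/ INR (S n)] is multiplied by [Series w]. *)
    destruct (proj2 (is_lim_seq_spec _ _) Hlim (mkposreal _ He4)) as [K HK].
    specialize (HK K (le_n K)). simpl in HK. apply Rabs_def2 in HK.
    destruct (INR_unbounded (2 * Series w / eps)) as [N HN].
    exists (max N (S K)). intros n Hn s [Hs _].
    eapply Rle_lt_trans.
    + apply (Cmod_dirichlet_sum_shift_le a (tau n) sigma1 (/ INR (S n)) K s);
        [exact ha|exact H1|exact Hs| |].
      * apply Rlt_le, Rinv_0_lt_compat, lt_0_INR. lia.
      * intros m Hm. apply Rlt_le, Happrox. lia.
    + fold w.
      assert (Hn' : 2 * Series w / eps < INR (S n)).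
      { eapply Rlt_le_trans; [exact HN|]. apply le_INR. lia. }
      assert (HSn : 0 < INR (S n)) by (apply lt_0_INR; lia).
      assert (/ INR (S n) * Series w < eps / 2); [|lra].
      apply Rmult_lt_reg_l with (2 * INR (S n) / eps).
      * apply Rdiv_lt_0_compat; lra.
      * replace (2 * INR (S n) / eps * (/ INR (S n) * Series w))
          with (2 * Series w / eps) by (field; lra).
        replace (2 * INR (S n) / eps * (eps / 2)) with (INR (S n)) by (field; lra).
        exact Hn'.
Qed.
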